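(* Let $R>1$ and let $f,g:\mathbb{D}_{R}\to\mathbb{C}$ be analytic in $\mathbb{D}_{R}=\{z\in\mathbb{C}:|z|<R\}$, $f(z)=\sum_{k=0}^{\infty}a_{k}z^{k}$, $g(z)=\sum_{k=0}^{\infty}b_{k}z^{k}$. Let $1\le r<R$. Then $\sum_{m=0}^{\infty}m^{2}\big[\sum_{j=0}^{m}|a_{j}||b_{m-j}|\big]r^{m}<+\infty$ and for all $n\in\mathbb{N}$, $$\|U_{n}(fg)-U_{n}(f)U_{n}(g)\|_{r}\le\frac{4}{n}\sum_{m=0}^{\infty}m^{2}\Big[\sum_{j=0}^{m}|a_{j}||b_{m-j}|\Big]r^{m}.$$
   Context: The complex genuine Bernstein-Durrmeyer polynomials of a function $h$ continuous on $[0,1]$ are $$U_{n}(h)(z)=(n-1)\sum_{k=1}^{n-1}\Big(\int_{0}^{1}h(t)p_{n-2,k-1}(t)\,dt\Big)p_{n,k}(z)+(1-z)^{n}h(0)+z^{n}h(1),\quad z\in\mathbb{C},$$ where $p_{n,k}(z)=\binom{n}{k}z^{k}(1-z)^{n-k}$. For $h$ continuous on $\{|z|\le r\}$, $\|h\|_{r}=\max\{|h(z)|:|z|\le r\}$. *)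

(* Defs.v *)
From Stdlib Require Import Reals.
From Coquelicot Require Import Coquelicot.

Open Scope C_scope.
Definition Cpw (z : C) (k : nat) : C := @pow_n C_Ring z k.

Definition pnk (n k : nat) (z : C) : C :=
  RtoC (Binomial.C n k) * Cpw z k * Cpw (1 - z) (n - k).

Definition CInt01 (F : R -> C) : C := RInt (V := C_R_CompleteNormedModule) F 0 1.

(* genuine Bernstein-Durrmeyer polynomial U_n(h)(z) (meaningful for n >= 1) *)
Definition U (n : nat) (h : C -> C) (z : C) : C :=
  RtoC (INR n - 1) *
    @sum_n_m C_AbelianGroup
      (fun k => CInt01 (fun t => h (RtoC t) * pnk (n - 2) (k - 1) (RtoC t)) * pnk n k z)
      1 (n - 1)
  + Cpw (1 - z) n * h (RtoC 0) + Cpw z n * h (RtoC 1).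

Close Scope C_scope.
Definition dseq (a b : nat -> C) (r : R) (m : nat) : R :=
  INR m ^ 2 * @sum_n R_AbelianGroup (fun j => Cmod (a j) * Cmod (b (m - j)%nat)) m * r ^ m.

(* Main.v *)
(* The value of [U_n] on the monomial [e_p = z^p] is
   [sum_k p_{n,k}(z) (k)^(p) / (n)^(p)], with [x^(p)] the rising factorial.  Rising
   factorials are nonnegative (Lah) combinations of falling ones, and the Bernstein
   operator sends the falling factorial of order [i] to a multiple of [z^i]; so
   [U_n e_p] is a convex combination of [1, z, ..., z^p], and the weight of [z^p]
   is at least [1 - p(p-1)/n].  For [|z| <= r], [r >= 1], this gives
   [|U_n e_p| <= r^p] and [|U_n e_p - e_p| <= 2 p(p-1) r^p / n], whence
   [|U_n e_{j+k} - U_n e_j U_n e_k| <= 4 (j+k)^2 r^(j+k) / n].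
   By bilinearity the theorem follows for the partial sums of [f] and [g] (a square
   of indices lies in a triangle), and then for [f] and [g] because the partial sums
   converge uniformly on [[0,1]], the only place where [U_n] looks. *)
Require Import Defs.
From Stdlib Require Import Reals.
From Coquelicot Require Import Coquelicot.
From Stdlib Require Import Lra Lia.

(** * Finite sums and powers *)

Definition RS (u : nat -> R) (n : nat) : R := @sum_n R_AbelianGroup u n.
Definition CS (u : nat -> C) (n : nat) : C := @sum_n C_AbelianGroup u n.

Lemma RS_O u : RS u 0 = u 0%nat.
Proof. exact (sum_O u). Qed.

Lemma RS_S u n : RS u (S n) = RS u n + u (S n).
Proof. exact (sum_Sn u n). Qed.

Lemma CS_O u : CS u 0 = u 0%nat.
Proof. exact (@sum_O C_AbelianGroup u). Qed.

Lemma CS_S u n : CS u (S n) = (CS u n + u (S n))%C.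
Proof. exact (@sum_Sn C_AbelianGroup u n). Qed.

Lemma RS_ext u v n : (forall k, (k <= n)%nat -> u k = v k) -> RS u n = RS v n.
Proof. exact (@sum_n_ext_loc R_AbelianGroup u v n). Qed.

Lemma CS_ext u v n : (forall k, (k <= n)%nat -> u k = v k) -> CS u n = CS v n.
Proof. exact (@sum_n_ext_loc C_AbelianGroup u v n). Qed.

Lemma RS_shift u n : RS u (S n) = u 0%nat + RS (fun k => u (S k)) n.
Proof.
  induction n as [|n IH].
  - now rewrite RS_S, !RS_O.
  - rewrite RS_S, IH, (RS_S (fun k => u (S k))). ring.
Qed.

Lemma CS_shift u n : CS u (S n) = (u 0%nat + CS (fun k => u (S k)) n)%C.
Proof.
  induction n as [|n IH].
  - now rewrite CS_S, !CS_O.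
  - rewrite CS_S, IH, (CS_S (fun k => u (S k))). ring.
Qed.

Lemma RS_le u v n : (forall k, (k <= n)%nat -> u k <= v k) -> RS u n <= RS v n.
Proof.
  induction n as [|n IH]; intros H.
  - rewrite !RS_O; auto.
  - rewrite !RS_S; apply Rplus_le_compat; auto.
Qed.

Lemma RS_plus u v n : RS (fun k => u k + v k) n = RS u n + RS v n.
Proof. exact (@sum_n_plus R_AbelianGroup u v n). Qed.

Lemma RS_scal c u n : RS (fun k => c * u k) n = c * RS u n.
Proof. exact (@sum_n_mult_l R_Ring c u n). Qed.

Lemma CS_plus u v n : CS (fun k => u k + v k)%C n = (CS u n + CS v n)%C.
Proof. exact (@sum_n_plus C_AbelianGroup u v n). Qed.

Lemma CS_scal c u n : CS (fun k => c * u k)%C n = (c * CS u n)%C.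
Proof. exact (@sum_n_mult_l C_Ring c u n). Qed.

Lemma CS_RtoC u n : CS (fun k => RtoC (u k)) n = RtoC (RS u n).
Proof.
  induction n as [|n IH].
  - now rewrite CS_O, RS_O.
  - now rewrite CS_S, RS_S, IH, RtoC_plus.
Qed.

Lemma CS_switch (u : nat -> nat -> C) m n :
  CS (fun i => CS (u i) n) m = CS (fun j => CS (fun i => u i j) m) n.
Proof. exact (@sum_n_switch C_AbelianGroup u m n). Qed.

Lemma CS_mul u v n m :
  (CS u n * CS v m)%C = CS (fun j => CS (fun k => u j * v k)%C m) n.
Proof.
  rewrite Cmult_comm, <- CS_scal.
  apply CS_ext; intros j _.
  now rewrite CS_scal, Cmult_comm.
Qed.

Lemma CS_minus u v n : CS (fun k => u k - v k)%C n = (CS u n - CS v n)%C.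
Proof.
  induction n as [|n IH].
  - now rewrite !CS_O.
  - rewrite !CS_S, IH. ring.
Qed.

Lemma Cmod_CS_le u v n :
  (forall k, (k <= n)%nat -> Cmod (u k) <= v k) -> Cmod (CS u n) <= RS v n.
Proof.
  induction n as [|n IH]; intros H.
  - rewrite CS_O, RS_O; auto.
  - rewrite CS_S, RS_S.
    eapply Rle_trans; [apply Cmod_triangle|].
    apply Rplus_le_compat; auto.
Qed.

Lemma Cpw_O z : Cpw z 0 = RtoC 1.
Proof. reflexivity. Qed.

Lemma Cpw_S z k : Cpw z (S k) = (z * Cpw z k)%C.
Proof. reflexivity. Qed.

Lemma Cpw_add z j k : Cpw z (j + k) = (Cpw z j * Cpw z k)%C.
Proof.
  induction j as [|j IH]; simpl Nat.add.
  - rewrite Cpw_O. ring.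
  - rewrite !Cpw_S, IH. ring.
Qed.

Lemma Cpw_RtoC x k : Cpw (RtoC x) k = RtoC (x ^ k).
Proof.
  induction k as [|k IH]; [reflexivity|].
  now rewrite Cpw_S, IH, <- RtoC_mult.
Qed.

Lemma Cmod_Cpw z k : Cmod (Cpw z k) = Cmod z ^ k.
Proof.
  induction k as [|k IH].
  - exact Cmod_1.
  - now rewrite Cpw_S, Cmod_mult, IH.
Qed.

Lemma Cmod_Cpw_le z r k : Cmod z <= r -> Cmod (Cpw z k) <= r ^ k.
Proof.
  intros H; rewrite Cmod_Cpw; apply pow_incr; split; [apply Cmod_ge_0 | exact H].
Qed.

Lemma Cmod_RtoC_mult x z : 0 <= x -> Cmod (RtoC x * z) = x * Cmod z.
Proof. intros H; now rewrite Cmod_mult, Cmod_R, Rabs_pos_eq. Qed.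

(** * Bernstein sums of factorials *)

(** The Bernstein polynomial with node values [phi k], indexed by [k] rather than [k/n] so that
    factorials in [k] can be inserted directly. *)
Definition bsum (n : nat) (phi : nat -> R) (z : C) : C :=
  CS (fun k => pnk n k z * RtoC (phi k))%C n.

Lemma binom_n_0 n : Binomial.C n 0 = 1.
Proof. unfold Binomial.C. rewrite Nat.sub_0_r. simpl. field. apply INR_fact_neq_0. Qed.

Lemma binom_n_n n : Binomial.C n n = 1.
Proof. unfold Binomial.C. rewrite Nat.sub_diag. simpl. field. apply INR_fact_neq_0. Qed.

Lemma pnk_0 n z : pnk n 0 z = Cpw (1 - z) n.
Proof. unfold pnk. rewrite binom_n_0, Nat.sub_0_r, Cpw_O. ring. Qed.

Lemma pnk_n n z : pnk n n z = Cpw z n.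
Proof. unfold pnk. rewrite binom_n_n, Nat.sub_diag, Cpw_O. ring. Qed.

Lemma pnk_pascal n k z : (k < n)%nat ->
  pnk (S n) (S k) z = ((1 - z) * pnk n (S k) z + z * pnk n k z)%C.
Proof.
  intros H. unfold pnk.
  rewrite <- pascal, RtoC_plus by exact H.
  replace (S n - S k)%nat with (S (n - S k)) by lia.
  replace (n - k)%nat with (S (n - S k)) by lia.
  rewrite !Cpw_S. ring.
Qed.

(** The de Casteljau recurrence: Pascal's rule splits every inner basis polynomial, and the two
    extreme ones are pure powers of [1 - z] and [z]. *)
Lemma bsum_S n phi z :
  bsum (S n) phi z
  = ((1 - z) * bsum n phi z + z * bsum n (fun k => phi (S k)) z)%C.
Proof.
  unfold bsum.
  (* Pascal's rule covers only the indices strictly between the ends, so degree 0, where no such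
     index arises, is computed directly. *)
  destruct n as [|n].
  - rewrite CS_S, !CS_O, !pnk_0, !pnk_n, !Cpw_S, !Cpw_O. ring.
  - rewrite CS_S, CS_shift, pnk_0, pnk_n, (CS_shift _ n), pnk_0.
    rewrite (CS_S (fun k => pnk (S n) k z * RtoC (phi (S k)))%C), pnk_n.
    rewrite (CS_ext (fun k => pnk (S (S n)) (S k) z * RtoC (phi (S k)))%C
      (fun k => (1 - z) * (pnk (S n) (S k) z * RtoC (phi (S k)))
                + z * (pnk (S n) k z * RtoC (phi (S k))))%C).
    + rewrite CS_plus, !CS_scal, !Cpw_S. ring.
    + intros k Hk. rewrite pnk_pascal by lia. ring.
Qed.

(** * Rising and falling factorials, Lah numbers *)

Fixpoint ris (x : R) (p : nat) : R :=
  match p with O => 1 | S q => ris x q * (x + INR q) end.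

Fixpoint ff (x : R) (p : nat) : R :=
  match p with O => 1 | S q => ff x q * (x - INR q) end.

Lemma ff_shift x i : ff (x + 1) (S i) = (x + 1) * ff x i.
Proof.
  induction i as [|i IH].
  - simpl; ring.
  - change (ff (x + 1) (S (S i))) with (ff (x + 1) (S i) * (x + 1 - INR (S i))).
    rewrite IH, S_INR. simpl. ring.
Qed.

Lemma ff_0 i : ff 0 (S i) = 0.
Proof.
  induction i as [|i IH]; [simpl; ring|].
  change (ff 0 (S (S i))) with (ff 0 (S i) * (0 - INR (S i))). rewrite IH. ring.
Qed.

Lemma bsum_1 n z : bsum n (fun _ => 1) z = RtoC 1.
Proof.
  induction n as [|n IH].
  - unfold bsum. rewrite CS_O. unfold pnk. rewrite binom_n_0.
    rewrite !Cpw_O. ring.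
  - rewrite bsum_S, IH. ring.
Qed.

Lemma bsum_lin n c phi psi z :
  bsum n (fun k => phi k + c * psi k) z = (bsum n phi z + RtoC c * bsum n psi z)%C.
Proof.
  unfold bsum. rewrite <- CS_scal, <- CS_plus. apply CS_ext; intros k _.
  rewrite RtoC_plus, RtoC_mult. ring.
Qed.

Lemma bsum_ext n phi psi z : (forall k, phi k = psi k) -> bsum n phi z = bsum n psi z.
Proof. intros H; apply CS_ext; intros k _; now rewrite H. Qed.

(** Induction on [n] with the de Casteljau recurrence. The falling factorial of order [i+1] at [k+1]
    is the one at [k] plus [i+1] times the one of order [i]; the terms in [z^(i+2)] then cancel, and
    the coefficient of [z^(i+1)] is [(n - i) + (i + 1) = n + 1] times the falling factorial of [n]
    of order [i]. *)
Lemma bsum_ff n i z :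
  bsum n (fun k => ff (INR k) i) z = (RtoC (ff (INR n) i) * Cpw z i)%C.
Proof.
  revert i; induction n as [|n IH]; intros [|i].
  - change (ff (INR 0) 0) with 1. rewrite bsum_1. rewrite Cpw_O. ring.
  - unfold bsum. rewrite CS_O. change (INR 0) with 0. rewrite ff_0. ring.
  - change (ff (INR (S n)) 0) with 1. rewrite bsum_1. rewrite Cpw_O. ring.
  - rewrite bsum_S, IH.
    rewrite (bsum_ext n _ (fun k => ff (INR k) (S i) + (INR (S i)) * ff (INR k) i)).
    + rewrite bsum_lin, !IH, Cpw_S.
      rewrite (S_INR n), ff_shift, S_INR. simpl.
      rewrite !RtoC_mult, RtoC_minus, !RtoC_plus. ring.
    + intros k. rewrite (S_INR k), ff_shift, S_INR. simpl. ring.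
Qed.

(** The unsigned Lah numbers, that is, the coefficients of a rising factorial in the basis of
    falling ones. *)
Fixpoint lah (p i : nat) : R :=
  match p, i with
  | O, O => 1
  | O, S _ => 0
  | S q, O => INR q * lah q 0
  | S q, S j => lah q j + (INR (S j) + INR q) * lah q (S j)
  end.

Lemma lah_pos p i : 0 <= lah p i.
Proof.
  revert i; induction p as [|p IH]; intros [|i]; cbn [lah]; try lra.
  - apply Rmult_le_pos; [apply pos_INR | apply IH].
  - apply Rplus_le_le_0_compat; [apply IH|].
    apply Rmult_le_pos; [|apply IH].
    apply Rplus_le_le_0_compat; apply pos_INR.
Qed.

Lemma lah_gt p i : (p < i)%nat -> lah p i = 0.
Proof.
  revert i; induction p as [|p IH]; intros [|i] H; try lia; cbn [lah]; [reflexivity|].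
  rewrite !IH by lia. ring.
Qed.

Lemma lah_diag p : lah p p = 1.
Proof.
  induction p as [|p IH]; [reflexivity|].
  cbn [lah]. rewrite IH, lah_gt by lia. ring.
Qed.

(** In the induction, the new factor is split as [x + p = (x - i) + (i + p)] against the term of
    order [i]: the first summand raises the order of the falling factorial by one, the second keeps
    it. This is exactly the recursion of [lah]. *)
Lemma ris_lah x p : ris x p = RS (fun i => lah p i * ff x i) p.
Proof.
  induction p as [|p IH].
  - rewrite RS_O; simpl; ring.
  - cbn [ris]. rewrite IH, RS_shift.
    (* [u] collects the order-preserving contributions. Its term at [p+1] vanishes because
       [lah p (p+1) = 0], so the shifted sum can be closed up again. *)
    set (u := fun i => (INR i + INR p) * (lah p i * ff x i)).
    assert (Hu : u 0%nat + RS (fun i => u (S i)) p = RS u p).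
    { rewrite <- RS_shift, RS_S. unfold u at 2. rewrite lah_gt by lia. ring. }
    rewrite (RS_ext (fun k => lah (S p) (S k) * ff x (S k))
      (fun k => u (S k) + (x - INR k) * (lah p k * ff x k))).
    + rewrite RS_plus, <- Rplus_assoc.
      replace (lah (S p) 0 * ff x 0) with (u 0%nat) by (unfold u; cbn [lah ff]; simpl INR; ring).
      rewrite Hu, <- RS_plus, Rmult_comm, <- RS_scal.
      apply RS_ext; intros k _. unfold u. ring.
    + intros k _. unfold u. cbn [lah ff]. ring.
Qed.

Lemma bsum_ris n p z :
  bsum n (fun k => ris (INR k) p) z
  = CS (fun i => RtoC (lah p i * ff (INR n) i) * Cpw z i)%C p.
Proof.
  unfold bsum.
  rewrite (CS_ext _ (fun k => CS (fun i =>
     RtoC (lah p i) * (pnk n k z * RtoC (ff (INR k) i)))%C p)).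
  - rewrite CS_switch. apply CS_ext; intros i _.
    rewrite CS_scal, RtoC_mult, <- Cmult_assoc, <- bsum_ff. reflexivity.
  - intros k _. rewrite ris_lah, <- CS_RtoC, <- CS_scal.
    apply CS_ext; intros i _. rewrite RtoC_mult. ring.
Qed.

Lemma ff_gt n p : (n < p)%nat -> ff (INR n) p = 0.
Proof.
  induction p as [|p IH]; [lia|]. intros H. cbn [ff].
  destruct (Nat.eq_dec n p) as [->|].
  - ring.
  - rewrite IH by lia. ring.
Qed.

(** Integrality of the argument matters: either all factors are nonnegative, or one of them is
    zero. *)
Lemma ff_pos n p : 0 <= ff (INR n) p.
Proof.
  induction p as [|p IH]; [simpl; lra|].
  destruct (Nat.le_gt_cases p n) as [H|H].
  - cbn [ff]. apply Rmult_le_pos; [exact IH|]. apply le_INR in H; lra.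
  - rewrite ff_gt by lia; lra.
Qed.

Lemma ris_pos n p : (1 <= n)%nat -> 0 < ris (INR n) p.
Proof.
  intros Hn. apply (lt_0_INR n) in Hn.
  induction p as [|p IH]; [simpl; lra|].
  cbn [ris]. apply Rmult_lt_0_compat; [exact IH|].
  pose proof (pos_INR p); lra.
Qed.

(** This bounds from below the relative weight of the top power [z^p]. The induction compares the
    new factors [n - p] and [n + p]. *)
Lemma ris_ff_bound n p : (1 <= n)%nat ->
  ris (INR n) p * (1 - INR p * (INR p - 1) / INR n) <= ff (INR n) p.
Proof.
  intros Hn. pose proof (lt_0_INR n Hn) as Hn'.
  induction p as [|p IH].
  - simpl. lra.
  - pose proof (ris_pos n p Hn) as Hr. pose proof (pos_INR p) as Hp.
    rewrite S_INR. cbn [ris ff].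
    destruct (Nat.le_gt_cases p n) as [H|H].
    + apply le_INR in H.
      eapply Rle_trans; [|apply Rmult_le_compat_r; [lra|exact IH]].
      rewrite !Rmult_assoc. apply Rmult_le_compat_l; [lra|].
      (* The difference [(n-p)(1 - p(p-1)/n) - (n+p)(1 - p(p+1)/n)] is exactly [2p^3/n]. *)
      apply Rminus_le_0.
      replace (_ - _) with (2 * INR p ^ 3 / INR n) by (field; lra).
      apply Rmult_le_pos; [|left; now apply Rinv_0_lt_compat].
      apply Rmult_le_pos; [lra|now apply pow_le].
    (* For [p > n] the falling factorial is zero, and [p(p+1)/n >= 1] makes the left side
       nonpositive. *)
    + rewrite (ff_gt n p) by exact H.
      assert (1 <= (INR p + 1) * (INR p + 1 - 1) / INR n).
      { apply lt_INR in H.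
        apply (Rmult_le_reg_r (INR n)); [exact Hn'|].
        unfold Rdiv. rewrite Rmult_assoc, Rinv_l by lra. nra. }
      assert (0 <= ris (INR n) p * (INR n + INR p)) by (apply Rmult_le_pos; lra).
      nra.
Qed.

Section MonomialEstimates.

Variables (n : nat) (z : C) (r : R).
Hypotheses (Hn : (1 <= n)%nat) (Hr : 1 <= r) (Hz : Cmod z <= r).

(** Since [r >= 1], [|z|^i <= r^i <= r^p]; the weights are nonnegative, so every term can be charged
    at [r^p]. By [ris_lah] the weights add up to the rising factorial of [n]. *)
Lemma Cmod_term_le i p : (i <= p)%nat ->
  Cmod (RtoC (lah p i * ff (INR n) i) * Cpw z i) <= r ^ p * (lah p i * ff (INR n) i).
Proof.
  intros Hi.
  assert (0 <= lah p i * ff (INR n) i).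
  { apply Rmult_le_pos; [apply lah_pos | apply ff_pos]. }
  rewrite Cmod_RtoC_mult, Rmult_comm by assumption.
  apply Rmult_le_compat_r; [assumption|].
  eapply Rle_trans; [apply (Cmod_Cpw_le z r), Hz | now apply Rle_pow].
Qed.

Lemma Cmod_bsum_ris p :
  Cmod (bsum n (fun k => ris (INR k) p) z) <= ris (INR n) p * r ^ p.
Proof.
  rewrite bsum_ris, (ris_lah (INR n)), Rmult_comm, <- RS_scal.
  apply Cmod_CS_le; intros i Hi. now apply Cmod_term_le.
Qed.

(** The top weight is the falling factorial of [n], since [lah p p = 1]. Hence the gap between
    rising and falling factorial is both the total weight of the lower powers and the missing
    coefficient of [z^p]; each of the two costs this gap times [r^p], whence the factor 2. *)
Lemma Cmod_bsum_ris_sub p :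
  Cmod (bsum n (fun k => ris (INR k) p) z - RtoC (ris (INR n) p) * Cpw z p)
  <= 2 * (ris (INR n) p - ff (INR n) p) * r ^ p.
Proof.
  rewrite bsum_ris.
  destruct p as [|p].
  - rewrite CS_O, Cpw_O. simpl.
    replace (_ - _)%C with (RtoC 0) by (rewrite Rmult_1_l; ring).
    rewrite Cmod_0. lra.
  - rewrite CS_S, lah_diag.
    assert (E : RS (fun i => r ^ S p * (lah (S p) i * ff (INR n) i)) p
                = (ris (INR n) (S p) - ff (INR n) (S p)) * r ^ S p).
    { rewrite RS_scal, (ris_lah (INR n) (S p)), RS_S, lah_diag. ring. }
    set (s := CS _ p).
    assert (Hs : Cmod s <= (ris (INR n) (S p) - ff (INR n) (S p)) * r ^ S p).
    { rewrite <- E. apply Cmod_CS_le; intros i Hi. apply Cmod_term_le; lia. }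
    (* The sign of the gap is read off from [Hs], whose left side is a modulus. *)
    assert (0 <= ris (INR n) (S p) - ff (INR n) (S p)).
    { apply (Rmult_le_reg_r (r ^ S p)); [apply pow_lt; lra|].
      rewrite Rmult_0_l. eapply Rle_trans; [apply Cmod_ge_0|exact Hs]. }
    rewrite Rmult_1_l.
    replace (s + _ - _)%C with
      (s + - (RtoC (ris (INR n) (S p) - ff (INR n) (S p)) * Cpw z (S p)))%C
      by (rewrite RtoC_minus; ring).
    eapply Rle_trans; [apply Cmod_triangle|].
    rewrite Cmod_opp, Cmod_RtoC_mult by assumption.
    replace (2 * _ * _) with ((ris (INR n) (S p) - ff (INR n) (S p)) * r ^ S p
       + (ris (INR n) (S p) - ff (INR n) (S p)) * r ^ S p) by ring.
    apply Rplus_le_compat; [exact Hs|].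
    apply Rmult_le_compat_l; [assumption|]. now apply Cmod_Cpw_le.
Qed.

End MonomialEstimates.

(** * Integrals and linearity *)

(** Euler's beta integral, by induction on [b] and integration by parts; [a] stays general because
    each step raises it. *)
Lemma is_RInt_beta a b :
  is_RInt (fun t => t ^ a * (1 - t) ^ b) 0 1
    (INR (Factorial.fact a) * INR (Factorial.fact b) / INR (Factorial.fact (a + b + 1))).
Proof.
  revert a; induction b as [|b IH]; intros a.
  - rewrite Nat.add_0_r, Nat.add_1_r.
    assert (Ha : INR (S a) <> 0) by (apply not_0_INR; lia).
    evar_last.
    + apply (is_RInt_derive (fun t => t ^ S a / INR (S a))).
      * intros t _. auto_derive; [exact I|].
        change (pred (S a)) with a. change (match a with O => 1 | S _ => INR a + 1 end) with (INR (S a)).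
        field. exact Ha.
      * intros t _. apply (@ex_derive_continuous R_AbsRing R_NormedModule). auto_derive. exact I.
    + rewrite pow1, pow_i by lia.
      rewrite fact_simpl, mult_INR. change (INR (Factorial.fact 0)) with 1.
      unfold minus, plus, opp; simpl (@opp _ _).
      pose proof (INR_fact_neq_0 a). simpl. field. split; assumption.
  - pose proof (IH (S a)) as H.
    assert (Ha : INR (S a) <> 0) by (apply not_0_INR; lia).
    (* The integrand is the derivative of [t^(a+1) (1-t)^(b+1) / (a+1)], which vanishes at both
       endpoints. *)
    assert (Hb : is_RInt (fun t => t ^ a * (1 - t) ^ S b
                 - INR (S b) / INR (S a) * (t ^ S a * (1 - t) ^ b)) 0 1 0).
    { evar_last.
      - apply (is_RInt_derive (fun t => t ^ S a * (1 - t) ^ S b / INR (S a))).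
        + intros t _. auto_derive; [exact I|].
          change (pred (S a)) with a. change (pred (S b)) with b.
          change (match a with O => 1 | S _ => INR a + 1 end) with (INR (S a)).
          change (match b with O => 1 | S _ => INR b + 1 end) with (INR (S b)).
          simpl pow. change (1 + - t) with (1 - t). field. exact Ha.
        + intros t _. apply (@ex_derive_continuous R_AbsRing R_NormedModule). auto_derive. exact I.
      - rewrite pow1, (pow_i (S a)) by lia. rewrite Rminus_diag, (pow_i (S b)) by lia.
        unfold minus, plus, opp; simpl. field. exact Ha. }
    apply (is_RInt_scal _ _ _ (INR (S b) / INR (S a))) in H.
    pose proof (is_RInt_plus _ _ _ _ _ _ Hb H) as H1.
    eapply is_RInt_ext; [|evar_last; [exact H1|]].
    + intros t _. unfold plus, scal; simpl. unfold mult; simpl. ring.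
    + change (0 + INR (S b) / INR (S a) * (INR (Factorial.fact (S a)) * INR (Factorial.fact b)
          / INR (Factorial.fact (S a + b + 1)))
        = INR (Factorial.fact a) * INR (Factorial.fact (S b)) / INR (Factorial.fact (a + S b + 1))).
      replace (a + S b + 1)%nat with (S a + b + 1)%nat by lia.
      rewrite (fact_simpl a), (fact_simpl b), !mult_INR.
      pose proof (INR_fact_neq_0 (S a + b + 1)).
      field. split; assumption.
Qed.

Ltac to_C := lazymatch goal with |- @eq _ ?x ?y => change (@eq C x y) end.

(** A relation rather than a value: it records integrability, which the total function [CInt01]
    cannot express. *)
Definition isI (F : R -> C) (v : C) : Prop := @is_RInt C_R_NormedModule F 0 1 v.

Lemma isI_CInt01 F v : isI F v -> CInt01 F = v.
Proof. exact (@is_RInt_unique C_R_CompleteNormedModule F 0 1 v). Qed.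

Lemma isI_plus F G u v : isI F u -> isI G v -> isI (fun t => F t + G t)%C (u + v)%C.
Proof. exact (@is_RInt_plus C_R_NormedModule F G 0 1 u v). Qed.

Lemma isI_ext F G v : (forall t, F t = G t) -> isI F v -> isI G v.
Proof. intros H. apply is_RInt_ext. intros t _; apply H. Qed.

Lemma isI_RtoC (phi : R -> R) v : is_RInt phi 0 1 v -> isI (fun t => RtoC (phi t)) (RtoC v).
Proof.
  intros H. apply (@is_RInt_fct_extend_pair R_NormedModule R_NormedModule); simpl.
  - exact H.
  - evar_last; [apply (@is_RInt_const R_NormedModule)|].
    unfold scal; simpl; unfold mult; simpl. ring.
Qed.

(** The integral lives in a real normed module, so a complex scalar is handled through real and
    imaginary parts. *)
Lemma isI_scal c F v : isI F v -> isI (fun t => c * F t)%C (c * v)%C.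
Proof.
  intros H.
  pose proof (@is_RInt_fct_extend_fst R_NormedModule R_NormedModule F 0 1 v H) as H1.
  pose proof (@is_RInt_fct_extend_snd R_NormedModule R_NormedModule F 0 1 v H) as H2.
  apply (@is_RInt_fct_extend_pair R_NormedModule R_NormedModule); simpl.
  - exact (@is_RInt_minus R_NormedModule _ _ _ _ _ _
      (@is_RInt_scal R_NormedModule _ _ _ (fst c) _ H1)
      (@is_RInt_scal R_NormedModule _ _ _ (snd c) _ H2)).
  - exact (@is_RInt_plus R_NormedModule _ _ _ _ _ _
      (@is_RInt_scal R_NormedModule _ _ _ (fst c) _ H2)
      (@is_RInt_scal R_NormedModule _ _ _ (snd c) _ H1)).
Qed.

(** The functions for which all integrals of the form used in [U] exist; [U n] is linear on them. *)
Definition Uok (n : nat) (h : C -> C) : Prop :=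
  forall k, exists v, isI (fun t => h (RtoC t) * pnk (n - 2) (k - 1) (RtoC t))%C v.

Lemma Uok_ext n h1 h2 : (forall w, h1 w = h2 w) -> Uok n h1 -> Uok n h2.
Proof.
  intros H H1 k. destruct (H1 k) as [v Hv]. exists v.
  eapply isI_ext; [|exact Hv]. intros t; simpl. now rewrite H.
Qed.

Lemma Uok_plus n h1 h2 : Uok n h1 -> Uok n h2 -> Uok n (fun w => h1 w + h2 w)%C.
Proof.
  intros H1 H2 k. destruct (H1 k) as [u Hu], (H2 k) as [v Hv]. exists (u + v)%C.
  eapply isI_ext; [|exact (isI_plus _ _ _ _ Hu Hv)].
  intros t; simpl. ring.
Qed.

Lemma Uok_scal n c h : Uok n h -> Uok n (fun w => c * h w)%C.
Proof.
  intros H k. destruct (H k) as [u Hu]. exists (c * u)%C.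
  eapply isI_ext; [|exact (isI_scal c _ _ Hu)].
  intros t; simpl. ring.
Qed.

Lemma Uok_CS n F N : (forall j, Uok n (F j)) -> Uok n (fun w => CS (fun j => F j w) N).
Proof.
  intros H. induction N as [|N IH].
  - eapply Uok_ext; [|exact (H 0%nat)]. intros w; now rewrite CS_O.
  - eapply Uok_ext; [|exact (Uok_plus _ _ _ IH (H (S N)))].
    intros w; now rewrite CS_S.
Qed.

Lemma U_eq n h I z :
  (forall k, isI (fun t => h (RtoC t) * pnk (n - 2) (k - 1) (RtoC t))%C (I k)) ->
  U n h z = (RtoC (INR n - 1) *
    @sum_n_m C_AbelianGroup (fun k => I k * pnk n k z) 1 (n - 1)
    + Cpw (1 - z) n * h (RtoC 0) + Cpw z n * h (RtoC 1))%C.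
Proof.
  intros H. unfold U. do 3 f_equal.
  apply (@sum_n_m_ext C_AbelianGroup). intros k. now rewrite (isI_CInt01 _ _ (H k)).
Qed.

Lemma U_ext n h1 h2 z : (forall w, h1 w = h2 w) -> U n h1 z = U n h2 z.
Proof.
  intros H. unfold U. rewrite !H. do 3 f_equal.
  apply (@sum_n_m_ext C_AbelianGroup). intros k. f_equal.
  apply (@RInt_ext C_R_CompleteNormedModule). intros t _. now rewrite H.
Qed.

Lemma Uok_CInt01 n h k : Uok n h ->
  isI (fun t => h (RtoC t) * pnk (n - 2) (k - 1) (RtoC t))%C
    (CInt01 (fun t => h (RtoC t) * pnk (n - 2) (k - 1) (RtoC t))%C).
Proof. intros H. destruct (H k) as [v Hv]. now rewrite (isI_CInt01 _ _ Hv). Qed.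

Lemma U_plus n h1 h2 z : Uok n h1 -> Uok n h2 ->
  U n (fun w => h1 w + h2 w)%C z = (U n h1 z + U n h2 z)%C.
Proof.
  intros H1 H2.
  rewrite (U_eq n _ (fun k =>
     CInt01 (fun t => h1 (RtoC t) * pnk (n - 2) (k - 1) (RtoC t))%C
     + CInt01 (fun t => h2 (RtoC t) * pnk (n - 2) (k - 1) (RtoC t))%C)%C).
  - unfold U.
    rewrite (@sum_n_m_ext C_AbelianGroup _ (fun k => plus
      (CInt01 (fun t => h1 (RtoC t) * pnk (n - 2) (k - 1) (RtoC t)) * pnk n k z : C_AbelianGroup)%C
      (CInt01 (fun t => h2 (RtoC t) * pnk (n - 2) (k - 1) (RtoC t)) * pnk n k z)%C)).
    + rewrite sum_n_m_plus. change (@plus C_AbelianGroup) with Cplus. ring.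
    + intros k. change (@plus C_AbelianGroup) with Cplus. to_C. ring.
  - intros k. eapply isI_ext; [|exact (isI_plus _ _ _ _ (Uok_CInt01 n h1 k H1) (Uok_CInt01 n h2 k H2))].
    intros t; simpl. ring.
Qed.

Lemma U_scal n c h z : Uok n h -> U n (fun w => c * h w)%C z = (c * U n h z)%C.
Proof.
  intros H.
  rewrite (U_eq n _ (fun k =>
     c * CInt01 (fun t => h (RtoC t) * pnk (n - 2) (k - 1) (RtoC t))%C)%C).
  - unfold U.
    set (u := fun k => (CInt01 (fun t => h (RtoC t) * pnk (n - 2) (k - 1) (RtoC t)) * pnk n k z)%C).
    rewrite (@sum_n_m_ext C_AbelianGroup _ (fun k => c * u k)%C).
    + pose proof (@sum_n_m_mult_l C_Ring c u 1 (n - 1) :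
        @sum_n_m C_AbelianGroup (fun k => c * u k)%C 1 (n - 1)
        = (c * @sum_n_m C_AbelianGroup u 1 (n - 1))%C) as E.
      rewrite E. ring.
    + intros k. unfold u. to_C. ring.
  - intros k. eapply isI_ext; [|exact (isI_scal c _ _ (Uok_CInt01 n h k H))].
    intros t; simpl. ring.
Qed.

Lemma U_CS n F N z : (forall j, Uok n (F j)) ->
  U n (fun w => CS (fun j => F j w) N) z = CS (fun j => U n (F j) z) N.
Proof.
  intros H. induction N as [|N IH].
  - rewrite CS_O. apply U_ext; intros w; now rewrite CS_O.
  - rewrite CS_S, <- IH, <- U_plus; [|apply Uok_CS, H|apply H].
    apply U_ext; intros w; now rewrite CS_S.
Qed.

(** * Monomials *)

Lemma isI_monomial n k p :
  isI (fun t => Cpw (RtoC t) p * pnk n k (RtoC t))%C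
    (RtoC (Binomial.C n k * (INR (Factorial.fact (p + k)) * INR (Factorial.fact (n - k))
       / INR (Factorial.fact (p + k + (n - k) + 1))))).
Proof.
  eapply isI_ext; [|exact (isI_RtoC _ _ (is_RInt_scal _ _ _ (Binomial.C n k) _ (is_RInt_beta (p + k) (n - k)))) ].
  intros t; unfold scal; simpl; unfold mult; simpl. unfold pnk.
  rewrite <- RtoC_minus, !Cpw_RtoC, pow_add, !RtoC_mult. ring.
Qed.

Lemma Uok_monomial n p : Uok n (fun w => Cpw w p).
Proof. intros k. eexists. apply isI_monomial. Qed.

(** Converts the factorials of the beta integral into rising factorials. *)
Lemma ris_fact k p : ris (INR (S k)) p * INR (Factorial.fact k) = INR (Factorial.fact (p + k)).
Proof.
  induction p as [|p IH]; [simpl; ring|].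
  change (S p + k)%nat with (S (p + k)).
  rewrite fact_simpl, mult_INR, <- IH. cbn [ris].
  replace (INR (S (p + k))) with (INR (S k) + INR p); [ring|].
  rewrite !S_INR, plus_INR. ring.
Qed.

(** With [0^0 = 1], this makes the value of [z^p] at 0 fit the general formula at the node
    [k = 0]. *)
Lemma ris_0 p : ris 0 p = 0 ^ p.
Proof.
  induction p as [|p IH]; [reflexivity|]. cbn [ris]. rewrite IH. destruct p; simpl; ring.
Qed.

(** By the beta integral, [(n-1)] times the integral of [t^p p_{n-2,k-1}(t)] is the quotient of the
    rising factorials of [k] and [n]. The boundary terms of [U] are the cases [k = 0] and [k = n] of
    the same formula. *)
Lemma U_monomial n p z : (1 <= n)%nat ->
  U n (fun w => Cpw w p) z = (RtoC (/ ris (INR n) p) * bsum n (fun k => ris (INR k) p) z)%C.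
Proof.
  intros Hn. pose proof (ris_pos n p Hn) as Hr.
  assert (Hi : (RtoC (/ ris (INR n) p) * RtoC (ris (INR n) p) = 1)%C).
  { rewrite <- RtoC_mult, Rinv_l by lra. reflexivity. }
  assert (H0 : (RtoC (/ ris (INR n) p) * RtoC (ris (INR 0) p) = Cpw (RtoC 0) p)%C).
  { rewrite Cpw_RtoC, <- RtoC_mult. f_equal. simpl (INR 0). rewrite ris_0.
    destruct p; simpl; [field|ring]. }
  assert (H1 : Cpw (RtoC 1) p = RtoC 1) by (rewrite Cpw_RtoC, pow1; reflexivity).
  unfold bsum.
  (* For [n = 1] only the two boundary terms are present; otherwise [n = m + 2] and the inner sum is
     reindexed from 0. *)
  destruct n as [|[|m]]; [lia| |].
  - unfold U. rewrite sum_n_m_zero by lia.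
    rewrite CS_S, CS_O, pnk_0, pnk_n, H1, <- H0.
    replace (INR 1 - 1) with 0 by (simpl; ring).
    rewrite !Cmult_plus_distr_l.
    replace (Cpw z 1 * 1)%C with (Cpw z 1 * (RtoC (/ ris (INR 1) p) * RtoC (ris (INR 1) p)))%C
      by (now rewrite Hi). ring.
  - rewrite (U_eq _ _ _ _ (fun k => isI_monomial (S (S m) - 2) (k - 1) p)).
    rewrite CS_S, CS_shift, pnk_0, pnk_n, H1, <- H0.
    replace (S (S m) - 1)%nat with (S m) by lia.
    replace (S (S m) - 2)%nat with m by lia.
    rewrite <- sum_n_m_S.
    change (@sum_n_m C_AbelianGroup ?u 0 m) with (CS u m).
    rewrite !Cmult_plus_distr_l, <- !CS_scal.
    rewrite (CS_ext _ (fun k => RtoC (/ ris (INR (S (S m))) p)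
       * (pnk (S (S m)) (S k) z * RtoC (ris (INR (S k)) p)))%C).
    + replace (Cpw z (S (S m)) * 1)%C with
        (Cpw z (S (S m)) * (RtoC (/ ris (INR (S (S m))) p) * RtoC (ris (INR (S (S m))) p)))%C
        by (now rewrite Hi). ring.
    + intros k Hk. replace (S k - 1)%nat with k by lia.
      rewrite !Cmult_assoc, <- RtoC_mult.
      rewrite <- (Cmult_assoc _ (pnk _ _ _)), (Cmult_comm (pnk _ _ _)), Cmult_assoc, <- RtoC_mult.
      do 2 f_equal.
      (* Apart from rising factorials, what remains is [(m+1) binom(m,k) k! (m-k)! = (m+1)!]. *)
      pose proof (ris_fact (S m) p) as E. rewrite <- ris_fact.
      replace (p + k + (m - k) + 1)%nat with (p + S m)%nat by lia.
      rewrite <- E, fact_simpl, mult_INR. unfold Binomial.C.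
      rewrite (S_INR (S m)).
      pose proof (INR_fact_neq_0 m). pose proof (INR_fact_neq_0 k).
      pose proof (INR_fact_neq_0 (m - k)).
      assert (INR (S m) <> 0) by (apply not_0_INR; lia).
      rewrite (S_INR (S m)) in Hr.
      field. repeat split; try assumption; lra.
Qed.

Section MonomialDefect.

Variables (n : nat) (z : C) (r : R).
Hypotheses (Hn : (1 <= n)%nat) (Hr : 1 <= r) (Hz : Cmod z <= r).

Let M (p : nat) : C := U n (fun w => Cpw w p) z.

Lemma Cmod_U_monomial p : Cmod (M p) <= r ^ p.
Proof.
  unfold M. rewrite U_monomial by exact Hn. pose proof (ris_pos n p Hn) as H.
  rewrite Cmod_RtoC_mult by (left; now apply Rinv_0_lt_compat).
  apply (Rmult_le_reg_l (ris (INR n) p)); [exact H|].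
  rewrite <- Rmult_assoc, Rinv_r, Rmult_1_l by lra.
  now apply Cmod_bsum_ris.
Qed.

Lemma Cmod_U_monomial_sub p :
  Cmod (M p - Cpw z p) <= 2 / INR n * (INR p * (INR p - 1)) * r ^ p.
Proof.
  unfold M. rewrite U_monomial by exact Hn. pose proof (ris_pos n p Hn) as H.
  pose proof (lt_0_INR n Hn) as Hn'.
  apply (Rmult_le_reg_l (ris (INR n) p)); [exact H|].
  rewrite <- Cmod_RtoC_mult by lra.
  replace (RtoC (ris (INR n) p) * _)%C with
    (bsum n (fun k => ris (INR k) p) z - RtoC (ris (INR n) p) * Cpw z p)%C.
  - eapply Rle_trans; [apply (Cmod_bsum_ris_sub n z r Hn Hr Hz)|].
    rewrite <- Rmult_assoc. apply Rmult_le_compat_r; [apply pow_le; lra|].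
    pose proof (ris_ff_bound n p Hn) as Hb.
    replace (ris (INR n) p * (2 / INR n * (INR p * (INR p - 1)))) with
      (2 * (ris (INR n) p - ris (INR n) p * (1 - INR p * (INR p - 1) / INR n)))
      by (field; lra).
    lra.
  - rewrite RtoC_inv by lra. field. intros E. apply RtoC_inj in E. lra.
Qed.

(* Insert [z^(j+k) = z^j z^k] and telescope the product. *)
Lemma Cmod_monomial_defect j k :
  Cmod (M (j + k) - M j * M k) <= 4 / INR n * (INR (j + k) ^ 2 * r ^ (j + k)).
Proof.
  pose proof (lt_0_INR n Hn) as Hn'.
  replace (M (j + k) - M j * M k)%C with
    ((M (j + k) - Cpw z (j + k)) + (- ((M j - Cpw z j) * Cpw z k) + - (M j * (M k - Cpw z k))))%C
    by (rewrite Cpw_add; ring).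
  eapply Rle_trans; [apply Cmod_triangle|].
  eapply Rle_trans; [apply Rplus_le_compat_l, Cmod_triangle|].
  rewrite !Cmod_opp, !Cmod_mult.
  pose proof (Cmod_U_monomial_sub (j + k)) as H1.
  assert (H2 : Cmod (M j - Cpw z j) * Cmod (Cpw z k)
     <= 2 / INR n * (INR j * (INR j - 1)) * r ^ j * r ^ k).
  { apply Rmult_le_compat; try apply Cmod_ge_0; [apply Cmod_U_monomial_sub|now apply Cmod_Cpw_le]. }
  assert (H3 : Cmod (M j) * Cmod (M k - Cpw z k)
     <= r ^ j * (2 / INR n * (INR k * (INR k - 1)) * r ^ k)).
  { apply Rmult_le_compat; try apply Cmod_ge_0; [apply Cmod_U_monomial|apply Cmod_U_monomial_sub]. }
  eapply Rle_trans; [exact (Rplus_le_compat _ _ _ _ H1 (Rplus_le_compat _ _ _ _ H2 H3))|].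
  rewrite pow_add, plus_INR. pose proof (pos_INR j) as Hj. pose proof (pos_INR k) as Hk.
  replace (_ + _) with (2 / INR n * ((INR j + INR k) * (INR j + INR k - 1)
    + INR j * (INR j - 1) + INR k * (INR k - 1)) * (r ^ j * r ^ k)) by ring.
  rewrite <- (Rmult_assoc (4 / INR n)). apply Rmult_le_compat_r.
  - apply Rmult_le_pos; apply pow_le; lra.
  (* The constant 4 arises from [(j+k)(j+k-1) + j(j-1) + k(k-1) <= 2 (j+k)^2]. *)
  - replace (4 / INR n) with (2 / INR n * 2) by (field; lra).
    rewrite Rmult_assoc. apply Rmult_le_compat_l; [|nra].
    apply Rdiv_le_0_compat; lra.
Qed.

End MonomialDefect.

(** * Passage to the limit *)

(** Convergence in [C] is stated as a real null sequence, so that the real limit theorems apply. *)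
Definition Ctends (u : nat -> C) (l : C) : Prop :=
  is_lim_seq (fun N => Cmod (u N - l)%C) 0.

Lemma is_lim_seq_0_le (u v : nat -> R) :
  (forall N, 0 <= u N <= v N) -> is_lim_seq v 0 -> is_lim_seq u 0.
Proof.
  intros H Hv. apply (is_lim_seq_le_le (fun _ => 0) u v); [exact H| |exact Hv].
  apply is_lim_seq_const.
Qed.

Lemma Ctends_const c : Ctends (fun _ => c) c.
Proof.
  unfold Ctends. apply (is_lim_seq_ext (fun _ => 0)); [|apply is_lim_seq_const].
  intros _. replace (c - c)%C with (RtoC 0) by ring. now rewrite Cmod_0.
Qed.

Lemma Ctends_plus u v l m :
  Ctends u l -> Ctends v m -> Ctends (fun N => u N + v N)%C (l + m)%C.
Proof.
  intros Hu Hv.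
  apply (is_lim_seq_0_le _ (fun N => Cmod (u N - l) + Cmod (v N - m))).
  - intros N; split; [apply Cmod_ge_0|].
    replace (_ - _)%C with ((u N - l) + (v N - m))%C by ring. apply Cmod_triangle.
  - replace (Finite 0) with (Finite (0 + 0)) by (f_equal; ring).
    now apply is_lim_seq_plus'.
Qed.

Lemma Ctends_mult u v l m :
  Ctends u l -> Ctends v m -> Ctends (fun N => u N * v N)%C (l * m)%C.
Proof.
  intros Hu Hv.
  apply (is_lim_seq_0_le _ (fun N => Cmod (u N - l) * Cmod (v N - m)
     + (Cmod l * Cmod (v N - m) + Cmod m * Cmod (u N - l)))).
  - intros N; split; [apply Cmod_ge_0|]. rewrite <- !Cmod_mult.
    replace (u N * v N - l * m)%C with
      ((u N - l) * (v N - m) + (l * (v N - m) + m * (u N - l)))%C by ring.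
    eapply Rle_trans; [apply Cmod_triangle|]. apply Rplus_le_compat_l, Cmod_triangle.
  - replace (Finite 0) with (Finite (0 * 0 + (Cmod l * 0 + Cmod m * 0))) by (f_equal; ring).
    apply is_lim_seq_plus'; [now apply is_lim_seq_mult'|].
    apply is_lim_seq_plus'; (apply is_lim_seq_mult'; [apply is_lim_seq_const|assumption]).
Qed.

Lemma Ctends_opp u l : Ctends u l -> Ctends (fun N => - u N)%C (- l)%C.
Proof.
  apply is_lim_seq_ext. intros N. rewrite <- Cmod_opp. f_equal. ring.
Qed.

Lemma Ctends_sum_n_m (u : nat -> nat -> C) l i m : (forall k, Ctends (fun N => u N k) (l k)) ->
  Ctends (fun N => @sum_n_m C_AbelianGroup (u N) i m) (@sum_n_m C_AbelianGroup l i m).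
Proof.
  intros H. induction m as [|m IH].
  - destruct i as [|i].
    + apply (is_lim_seq_ext (fun N => Cmod (u N 0%nat - l 0%nat)%C)); [|apply H].
      intros N. now rewrite !(@sum_n_n C_AbelianGroup).
    + apply (is_lim_seq_ext (fun _ => Cmod (RtoC 0 - RtoC 0)%C)); [|exact (Ctends_const (RtoC 0))].
      intros N. now rewrite !(@sum_n_m_zero C_AbelianGroup) by lia.
  - destruct (Nat.le_gt_cases i (S m)) as [Hi|Hi].
    + apply (is_lim_seq_ext (fun N => Cmod ((@sum_n_m C_AbelianGroup (u N) i m + u N (S m))
        - (@sum_n_m C_AbelianGroup l i m + l (S m)))%C)).
      * intros N. now rewrite !(@sum_n_Sm C_AbelianGroup) by lia.
      * apply (Ctends_plus _ _ _ _ IH (H (S m))).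
    + apply (is_lim_seq_ext (fun _ => Cmod (RtoC 0 - RtoC 0)%C)); [|exact (Ctends_const (RtoC 0))].
      intros N. now rewrite !(@sum_n_m_zero C_AbelianGroup) by lia.
Qed.

Lemma Cmod_pnk_le n k t : 0 <= t <= 1 -> Cmod (pnk n k (RtoC t)) <= Rabs (Binomial.C n k).
Proof.
  intros Ht. unfold pnk. rewrite !Cmod_mult, Cmod_R, !Cmod_Cpw, <- RtoC_minus, !Cmod_R.
  rewrite Rmult_assoc. rewrite <- Rmult_1_r. apply Rmult_le_compat_l; [apply Rabs_pos|].
  rewrite !Rabs_pos_eq by lra.
  assert (H : forall s m, 0 <= s <= 1 -> 0 <= s ^ m <= 1).
  { intros s m Hs. split; [now apply pow_le|].
    rewrite <- (pow1 m). now apply pow_incr. }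
  pose proof (H t k Ht). assert (H1 : 0 <= 1 - t <= 1) by lra.
  pose proof (H (1 - t) (n - k)%nat H1). nra.
Qed.

(** Uniform convergence on [[0,1]] passes through the finitely many integrals and the two endpoint
    values. Integrability of the limit is part of the outcome. *)
Lemma U_tends n (hN : nat -> C -> C) h (e : nat -> R) z :
  (forall N, Uok n (hN N)) ->
  (forall N t, 0 <= t <= 1 -> Cmod (hN N (RtoC t) - h (RtoC t)) <= e N) ->
  is_lim_seq e 0 ->
  Ctends (fun N => U n (hN N) z) (U n h z).
Proof.
  intros Hok He Hlim.
  assert (Hpt : forall t, 0 <= t <= 1 -> Ctends (fun N => hN N (RtoC t)) (h (RtoC t))).
  { intros t Ht. apply (is_lim_seq_0_le _ e); [|exact Hlim].
    intros N; split; [apply Cmod_ge_0|now apply He]. }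
  assert (Hint : forall k, Ctends
     (fun N => CInt01 (fun t => hN N (RtoC t) * pnk (n - 2) (k - 1) (RtoC t))%C)
     (CInt01 (fun t => h (RtoC t) * pnk (n - 2) (k - 1) (RtoC t))%C)).
  { intros k.
    (* [filterlim_RInt] asks for uniform convergence on the whole line. Clamping the argument to
       [[0,1]] provides it and leaves the integrands unchanged on [(0,1)]. *)
    set (cl := fun t => Rmax 0 (Rmin 1 t)).
    assert (Hcl : forall t, 0 <= cl t <= 1).
    { intros t. unfold cl, Rmax, Rmin. destruct (Rle_dec 1 t), (Rle_dec 0 _); lra. }
    assert (Hcl1 : forall t, 0 < t < 1 -> cl t = t).
    { intros t Ht. unfold cl. rewrite Rmin_right, Rmax_right; lra. }
    set (F := fun (h : C -> C) t => (h (RtoC (cl t)) * pnk (n - 2) (k - 1) (RtoC (cl t)))%C).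
    assert (HF : forall h t, Rmin 0 1 < t < Rmax 0 1 ->
       (h (RtoC t) * pnk (n - 2) (k - 1) (RtoC t))%C = F h t).
    { intros h' t. rewrite Rmin_left, Rmax_right by lra. intros Ht.
      unfold F. now rewrite Hcl1. }
    destruct (@filterlim_RInt nat C_R_CompleteNormedModule (fun N => F (hN N)) 0 1 eventually
       eventually_filter (F h)
       (fun N => CInt01 (fun t => hN N (RtoC t) * pnk (n - 2) (k - 1) (RtoC t))%C))
      as [I [HI1 HI2]].
    - intros N. apply (@is_RInt_ext C_R_NormedModule _ _ _ _ _ (HF (hN N))).
      exact (Uok_CInt01 n (hN N) k (Hok N)).
    - apply filterlim_locally. intros eps.
      (* The added 1 makes [B] positive, so that [eps / B] is a legitimate tolerance. *)
      set (B := Rabs (Binomial.C (n - 2) (k - 1)) + 1).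
      assert (HB : 0 < B) by (unfold B; pose proof (Rabs_pos (Binomial.C (n - 2) (k - 1))); lra).
      assert (Hd : 0 < eps / B) by (apply Rdiv_lt_0_compat; [apply cond_pos|exact HB]).
      apply is_lim_seq_spec in Hlim. destruct (Hlim (mkposreal _ Hd)) as [N0 HN0].
      exists N0. intros N HN t.
      apply C_NormedModule_mixin_compat1.
      specialize (HN0 N HN). simpl in HN0. rewrite Rminus_0_r in HN0.
      unfold F. change (@minus _) with Cminus.
      replace (_ - _)%C with ((hN N (RtoC (cl t)) - h (RtoC (cl t))) * pnk (n - 2) (k - 1) (RtoC (cl t)))%C
        by ring.
      rewrite Cmod_mult.
      apply Rle_lt_trans with (Rabs (e N) * B).
      + apply Rmult_le_compat; try apply Cmod_ge_0.
        * eapply Rle_trans; [now apply He|apply Rle_abs].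
        * eapply Rle_trans; [now apply Cmod_pnk_le|unfold B; lra].
      + apply (Rmult_lt_compat_r B) in HN0; [|exact HB].
        unfold Rdiv in HN0. rewrite Rmult_assoc, Rinv_l in HN0 by lra. lra.
    - assert (E : CInt01 (fun t => h (RtoC t) * pnk (n - 2) (k - 1) (RtoC t))%C = I).
      { apply isI_CInt01. apply (@is_RInt_ext C_R_NormedModule (F h)); [|exact HI2].
        intros t Ht. symmetry. now apply HF. }
      rewrite E.
      apply is_lim_seq_spec. intros eps.
      destruct (proj1 (@filterlim_locally_ball_norm R_AbsRing nat C_R_NormedModule eventually _ _ _) HI1 eps)
        as [N0 HN0].
      exists N0. intros N HN. rewrite Rminus_0_r, Rabs_pos_eq by apply Cmod_ge_0.
      specialize (HN0 N HN). unfold ball_norm in HN0.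
      rewrite Cmod_norm. exact HN0. }
  unfold U.
  apply Ctends_plus; [apply Ctends_plus|].
  - apply Ctends_mult; [apply Ctends_const|].
    apply (Ctends_sum_n_m (fun N k =>
      (CInt01 (fun t => hN N (RtoC t) * pnk (n - 2) (k - 1) (RtoC t)) * pnk n k z)%C)
      (fun k => (CInt01 (fun t => h (RtoC t) * pnk (n - 2) (k - 1) (RtoC t)) * pnk n k z)%C)).
    intros k. apply Ctends_mult; [apply Hint|apply Ctends_const].
  - apply Ctends_mult; [apply Ctends_const|]. apply Hpt; lra.
  - apply Ctends_mult; [apply Ctends_const|]. apply Hpt; lra.
Qed.

(** * Geometric majorants and double sums *)

Lemma RS_geom_le q n : 0 <= q < 1 -> RS (fun k => q ^ k) n <= / (1 - q).
Proof.
  intros Hq. apply (Rmult_le_reg_l (1 - q)); [lra|]. rewrite Rinv_r by lra.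
  apply Rle_trans with (1 - q ^ S n); [right|pose proof (pow_le q (S n) (proj1 Hq)); lra].
  induction n as [|n IH].
  - rewrite RS_O. simpl. ring.
  - rewrite RS_S, Rmult_plus_distr_l, IH. simpl. ring.
Qed.

Lemma RS_const c n : RS (fun _ => c) n = (INR n + 1) * c.
Proof.
  induction n as [|n IH]; [rewrite RS_O; simpl; ring|].
  rewrite RS_S, IH, S_INR. ring.
Qed.

(** Each of the [n + 1] copies of [q^n] is at most one of the [q^k] with [k <= n], so the geometric
    sum dominates. *)
Lemma linear_geom_le q n : 0 <= q < 1 -> (INR n + 1) * q ^ n <= / (1 - q).
Proof.
  intros Hq. rewrite <- RS_const.
  eapply Rle_trans; [|apply (RS_geom_le q n Hq)].
  apply RS_le. intros k Hk.
  replace n with (k + (n - k))%nat by lia. rewrite pow_add.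
  rewrite <- (Rmult_1_r (q ^ k)) at 2.
  apply Rmult_le_compat_l; [apply pow_le; lra|].
  rewrite <- (pow1 (n - k)). apply pow_incr; lra.
Qed.

(** With [s] the fourth root of [q], three of the four factors [s^m] absorb [(m+1)^3], and the
    fourth leaves a convergent geometric series. *)
Lemma ex_series_cubic_geom c q : 0 <= q < 1 ->
  ex_series (fun m => c * ((INR m + 1) ^ 3 * q ^ m)).
Proof.
  intros Hq. apply (ex_series_scal (K := R_AbsRing) (V := R_NormedModule)).
  set (s := sqrt (sqrt q)).
  assert (Hs4 : s * s * (s * s) = q).
  { unfold s. rewrite sqrt_sqrt by apply sqrt_pos. apply sqrt_sqrt; lra. }
  assert (Hs : 0 <= s < 1).
  { split; [apply sqrt_pos|]. unfold s. rewrite <- sqrt_1. apply sqrt_lt_1_alt.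
    split; [apply sqrt_pos|]. rewrite <- sqrt_1. now apply sqrt_lt_1_alt. }
  apply (ex_series_le (K := R_AbsRing) (V := R_CompleteNormedModule) _ (fun m => (/ (1 - s)) ^ 3 * s ^ m)).
  - intros m. change (Rabs ((INR m + 1) ^ 3 * q ^ m) <= (/ (1 - s)) ^ 3 * s ^ m).
    pose proof (pos_INR m).
    assert (Hsm : 0 <= s ^ m) by (apply pow_le; lra).
    rewrite Rabs_pos_eq.
    + rewrite <- Hs4, !Rpow_mult_distr.
      replace (_ * _) with (((INR m + 1) * s ^ m) ^ 3 * s ^ m) by ring.
      apply Rmult_le_compat_r; [exact Hsm|]. apply pow_incr. split.
      * apply Rmult_le_pos; lra.
      * now apply linear_geom_le.
    + apply Rmult_le_pos; apply pow_le; lra.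
  - apply (ex_series_scal (K := R_AbsRing) (V := R_NormedModule)), ex_series_geom.
    rewrite Rabs_pos_eq; lra.
Qed.

Lemma RS_le_Series u n : (forall k, 0 <= u k) -> ex_series u -> RS u n <= Series u.
Proof.
  intros Hu Hex. apply Series_correct in Hex.
  apply (is_lim_seq_incr_compare (RS u)); [exact Hex|].
  intros k. rewrite RS_S. specialize (Hu (S k)). lra.
Qed.

(** Passing from [n] to [n+1] adds one antidiagonal, that is, one more entry in every row together
    with a new row of length one. *)
Lemma RS_triangle (T : nat -> nat -> R) n :
  RS (fun m => RS (fun j => T j (m - j)%nat) m) n
  = RS (fun j => RS (T j) (n - j)) n.
Proof.
  induction n as [|n IH].
  - now rewrite !RS_O.
  - rewrite RS_S, IH, RS_S, (RS_S (fun j => RS (T j) (S n - j))), Nat.sub_diag, RS_O.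
    rewrite <- Rplus_assoc, <- RS_plus. f_equal.
    apply RS_ext. intros j Hj. rewrite (Nat.sub_succ_l j n Hj). symmetry. apply RS_S.
Qed.

Lemma RS_le_n u n m : (forall k, 0 <= u k) -> (n <= m)%nat -> RS u n <= RS u m.
Proof.
  intros Hu. induction 1 as [|m _ IH]; [lra|]. rewrite RS_S. specialize (Hu (S m)). lra.
Qed.

Lemma RS_pos u n : (forall k, 0 <= u k) -> 0 <= RS u n.
Proof.
  intros Hu. apply Rle_trans with (RS u 0); [rewrite RS_O; apply Hu|].
  apply RS_le_n; [exact Hu|lia].
Qed.

(** The square of indices up to [n] lies in the triangle [j + k <= 2n], and the entries are
    nonnegative. *)
Lemma RS_square_le (T : nat -> nat -> R) n : (forall j k, 0 <= T j k) ->
  RS (fun j => RS (T j) n) n <= RS (fun m => RS (fun j => T j (m - j)%nat) m) (n + n).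
Proof.
  intros HT. rewrite RS_triangle.
  apply Rle_trans with (RS (fun j => RS (T j) (n + n - j)) n).
  - apply RS_le. intros j Hj. apply RS_le_n; [apply HT|lia].
  - apply RS_le_n; [|lia]. intros j. apply RS_pos, HT.
Qed.

(** * Partial sums of power series *)

Definition psum (a : nat -> C) (N : nat) (w : C) : C :=
  CS (fun k => a k * Cpw w k)%C N.

Lemma is_series_Ctends a z l : is_series (fun k => (a k * Cpw z k)%C) l ->
  Ctends (fun N => psum a N z) l.
Proof.
  intros H. apply is_lim_seq_spec. intros eps.
  destruct (proj1 (@filterlim_locally_ball_norm C_AbsRing nat C_NormedModule eventually _ _ _) H eps)
        as [N0 HN0].
  exists N0. intros N HN. rewrite Rminus_0_r, Rabs_pos_eq by apply Cmod_ge_0.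
  exact (HN0 N HN).
Qed.

(** A term of a convergent series is the difference of two consecutive partial sums, and these stay
    within a fixed distance of the limit. *)
Lemma Cauchy_coeff_bound a rho l : is_series (fun k => (a k * Cpw (RtoC rho) k)%C) l ->
  0 < rho -> exists M, 0 <= M /\ forall k, Cmod (a k) * rho ^ k <= M.
Proof.
  intros H Hrho. apply is_series_Ctends in H.
  assert (Hb : exists B, forall N, Cmod (psum a N (RtoC rho) - l) <= B).
  { apply is_lim_seq_spec in H. destruct (H (mkposreal 1 Rlt_0_1)) as [N0 HN0].
    (* 1 serves from the index [N0] on; the sum dominates each of the finitely many earlier
       distances. *)
    exists (1 + RS (fun N => Cmod (psum a N (RtoC rho) - l)) N0). intros N.
    pose proof (RS_pos (fun N => Cmod (psum a N (RtoC rho) - l)) N0 (fun k => Cmod_ge_0 _)).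
    destruct (Nat.le_gt_cases N0 N) as [HN|HN].
    - specialize (HN0 N HN). simpl in HN0. rewrite Rminus_0_r in HN0.
      rewrite Rabs_pos_eq in HN0 by apply Cmod_ge_0. lra.
    - apply Rle_trans with (RS (fun N => Cmod (psum a N (RtoC rho) - l)) N).
      + destruct N as [|N]; [rewrite RS_O; lra|]. rewrite RS_S.
        pose proof (RS_pos (fun N => Cmod (psum a N (RtoC rho) - l)) N (fun k => Cmod_ge_0 _)). lra.
      + apply Rle_trans with (RS (fun N => Cmod (psum a N (RtoC rho) - l)) N0); [|lra].
        apply RS_le_n; [intros; apply Cmod_ge_0|lia]. }
  destruct Hb as [B HB].
  assert (HB0 : 0 <= B) by (eapply Rle_trans; [apply Cmod_ge_0|apply (HB 0%nat)]).
  exists (Cmod (a 0%nat) + (B + B)). pose proof (Cmod_ge_0 (a 0%nat)) as Ha0.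
  split; [lra|]. intros [|k]; [simpl; lra|].
  assert (E : Cmod (a (S k)) * rho ^ S k = Cmod (a (S k) * Cpw (RtoC rho) (S k))).
  { rewrite Cmod_mult, Cmod_Cpw, Cmod_R, Rabs_pos_eq; lra. }
  rewrite E.
  replace (a (S k) * Cpw (RtoC rho) (S k))%C with
    ((psum a (S k) (RtoC rho) - l) + - (psum a k (RtoC rho) - l))%C
    by (unfold psum; rewrite CS_S; ring).
  eapply Rle_trans; [apply Cmod_triangle|]. rewrite Cmod_opp.
  pose proof (HB k). pose proof (HB (S k)). lra.
Qed.

Section UnitDisc.

Variables (R0 rho : R) (f : C -> C) (a : nat -> C).
Hypotheses (Hrho : 1 < rho < R0)
  (Hf : forall z : C, Cmod z < R0 -> is_series (fun k => (a k * Cpw z k)%C) (f z)).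

(** The coefficients are [O(rho^(-k))] with [rho > 1], so on the closed unit disc the tails are
    geometric. *)
Lemma psum_unif : exists K, 0 <= K /\
  forall N z, Cmod z <= 1 -> Cmod (psum a N z - f z) <= K * (/ rho) ^ N.
Proof.
  destruct (Cauchy_coeff_bound a rho (f (RtoC rho))) as [M [HM0 HM]].
  { apply Hf. rewrite Cmod_R, Rabs_pos_eq; lra. }
  { lra. }
  set (q := / rho).
  assert (Hq : 0 < q < 1).
  { split; [apply Rinv_0_lt_compat; lra|]. rewrite <- Rinv_1. apply Rinv_lt_contravar; lra. }
  assert (Hterm : forall k z, Cmod z <= 1 -> Cmod (a k * Cpw z k) <= M * q ^ k).
  { intros k z Hz. rewrite Cmod_mult.
    apply Rle_trans with (Cmod (a k) * 1).
    - apply Rmult_le_compat_l; [apply Cmod_ge_0|].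
      rewrite <- (pow1 k). now apply Cmod_Cpw_le.
    - rewrite Rmult_1_r. unfold q. rewrite pow_inv.
      apply (Rmult_le_reg_r (rho ^ k)); [apply pow_lt; lra|].
      rewrite Rmult_assoc, Rinv_l, Rmult_1_r by (apply pow_nonzero; lra). apply HM. }
  (* The difference [q^N - q^(N+d)] on the right makes the induction on [d] close with equality. *)
  assert (Htail : forall N d z, Cmod z <= 1 ->
     Cmod (psum a (N + d) z - psum a N z) <= M * q / (1 - q) * (q ^ N - q ^ (N + d))).
  { intros N d z Hz. induction d as [|d IH].
    - rewrite Nat.add_0_r. replace (_ - _)%C with (RtoC 0) by ring. rewrite Cmod_0. lra.
    - rewrite Nat.add_succ_r. unfold psum at 1. rewrite CS_S. fold (psum a (N + d) z).
      replace (_ - _)%C with ((psum a (N + d) z - psum a N z)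
        + a (S (N + d)) * Cpw z (S (N + d)))%C by ring.
      eapply Rle_trans; [apply Cmod_triangle|].
      eapply Rle_trans; [exact (Rplus_le_compat _ _ _ _ IH (Hterm (S (N + d)) z Hz))|].
      right. simpl. field. lra. }
  exists (M * q / (1 - q)).
  assert (HK : 0 <= M * q / (1 - q)).
  { apply Rdiv_le_0_compat; [apply Rmult_le_pos|]; lra. }
  split; [exact HK|]. intros N z Hz. apply le_epsilon. intros eps Heps.
  (* A far partial sum is within [eps] of [f z], so the uniform bound on finite tails passes to the
     limit. *)
  assert (Hl : Ctends (fun N => psum a N z) (f z)) by (apply is_series_Ctends, Hf; lra).
  apply is_lim_seq_spec in Hl. destruct (Hl (mkposreal eps Heps)) as [N0 HN0].
  specialize (HN0 (N + N0)%nat (Nat.le_add_l _ _)). simpl in HN0. rewrite Rminus_0_r in HN0.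
  rewrite Rabs_pos_eq in HN0 by apply Cmod_ge_0.
  replace (psum a N z - f z)%C with
    (- (psum a (N + N0) z - psum a N z) + (psum a (N + N0) z - f z))%C by ring.
  eapply Rle_trans; [apply Cmod_triangle|]. rewrite Cmod_opp.
  apply Rplus_le_compat; [|lra].
  eapply Rle_trans; [now apply Htail|]. apply Rmult_le_compat_l; [exact HK|].
  pose proof (pow_le q (N + N0)). lra.
Qed.

End UnitDisc.

(** The coefficient bounds [A rho^(-j)] and [B rho^(-k)] make the inner sum at most
    [(m+1) A B rho^(-m)]; hence the term is at most [A B (m+1)^3 (r/rho)^m]. *)
Lemma ex_series_dseq a b r rho la lb : 1 <= r < rho ->
  is_series (fun k => (a k * Cpw (RtoC rho) k)%C) la ->
  is_series (fun k => (b k * Cpw (RtoC rho) k)%C) lb ->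
  ex_series (dseq a b r).
Proof.
  intros Hr Ha Hb.
  destruct (Cauchy_coeff_bound _ _ _ Ha) as [A [HA0 HA]]; [lra|].
  destruct (Cauchy_coeff_bound _ _ _ Hb) as [B [HB0 HB]]; [lra|].
  assert (Hq : 0 <= r / rho < 1).
  { split; [apply Rdiv_le_0_compat; lra|]. apply (Rmult_lt_reg_r rho); [lra|].
    unfold Rdiv. rewrite Rmult_assoc, Rinv_l; lra. }
  apply (ex_series_le (K := R_AbsRing) (V := R_CompleteNormedModule) _
    (fun m => A * B * ((INR m + 1) ^ 3 * (r / rho) ^ m))); [|now apply ex_series_cubic_geom].
  intros m. change (Rabs (dseq a b r m) <= A * B * ((INR m + 1) ^ 3 * (r / rho) ^ m)).
  unfold dseq. change (@sum_n R_AbelianGroup ?u m) with (RS u m).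
  set (s := RS _ m).
  assert (Hs0 : 0 <= s).
  { apply RS_pos. intros k. apply Rmult_le_pos; apply Cmod_ge_0. }
  assert (Hrm : 0 < rho ^ m) by (apply pow_lt; lra).
  assert (Hs : rho ^ m * s <= (INR m + 1) * (A * B)).
  { unfold s. rewrite <- RS_scal, <- RS_const. apply RS_le. intros k Hk.
    replace (rho ^ m) with (rho ^ k * rho ^ (m - k)) by (rewrite <- pow_add; f_equal; lia).
    replace (_ * _) with ((Cmod (a k) * rho ^ k) * (Cmod (b (m - k)%nat) * rho ^ (m - k))) by ring.
    apply Rmult_le_compat; [| |apply HA|apply HB];
      (apply Rmult_le_pos; [apply Cmod_ge_0|apply pow_le; lra]). }
  pose proof (pos_INR m) as Hm. assert (Hrp : 0 <= r ^ m) by (apply pow_le; lra).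
  rewrite Rabs_pos_eq.
  - unfold Rdiv. rewrite Rpow_mult_distr, pow_inv.
    apply (Rmult_le_reg_r (rho ^ m)); [exact Hrm|].
    replace (A * B * _ * _) with ((INR m + 1) ^ 2 * ((INR m + 1) * (A * B)) * r ^ m)
      by (field; lra).
    replace (_ * _ * _ * _) with (INR m ^ 2 * (rho ^ m * s) * r ^ m) by ring.
    apply Rmult_le_compat_r; [exact Hrp|].
    apply Rmult_le_compat; [apply pow_le; lra|apply Rmult_le_pos; lra| |exact Hs].
    apply pow_incr; lra.
  - apply Rmult_le_pos; [apply Rmult_le_pos; [apply pow_le|]|]; lra.
Qed.

Lemma dseq_pos a b r m : 0 <= r -> 0 <= dseq a b r m.
Proof.
  intros Hr. unfold dseq. apply Rmult_le_pos; [apply Rmult_le_pos|apply pow_le; lra].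
  - apply pow_le, pos_INR.
  - apply (RS_pos (fun j => Cmod (a j) * Cmod (b (m - j)%nat))).
    intros k. apply Rmult_le_pos; apply Cmod_ge_0.
Qed.

(** * The operator on partial sums and their products *)

Lemma Uok_psum n a N : Uok n (psum a N).
Proof. apply (Uok_CS n (fun k w => a k * Cpw w k)%C). intros k. apply Uok_scal, Uok_monomial. Qed.

Lemma U_psum n a N z :
  U n (psum a N) z = CS (fun k => a k * U n (fun w => Cpw w k) z)%C N.
Proof.
  unfold psum. rewrite (U_CS n (fun k w => a k * Cpw w k)%C).
  - apply CS_ext. intros k _. apply U_scal, Uok_monomial.
  - intros k. apply Uok_scal, Uok_monomial.
Qed.

Lemma psum_mul a b N w :
  CS (fun j => CS (fun k => a j * b k * Cpw w (j + k)) N)%C N = (psum a N w * psum b N w)%C.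
Proof.
  unfold psum. rewrite CS_mul. apply CS_ext; intros j _. apply CS_ext; intros k _.
  rewrite Cpw_add. ring.
Qed.

Lemma Uok_psum_mul n a b N : Uok n (fun w => psum a N w * psum b N w)%C.
Proof.
  eapply Uok_ext; [intros w; apply psum_mul|].
  apply (Uok_CS n (fun j w => CS (fun k => a j * b k * Cpw w (j + k))%C N)). intros j.
  apply (Uok_CS n (fun k w => a j * b k * Cpw w (j + k))%C). intros k.
  apply Uok_scal, Uok_monomial.
Qed.

Lemma U_psum_mul n a b N z :
  U n (fun w => psum a N w * psum b N w)%C z
  = CS (fun j => CS (fun k => a j * b k * U n (fun w => Cpw w (j + k)) z) N)%C N.
Proof.
  assert (Hok : forall j k, Uok n (fun w => a j * b k * Cpw w (j + k))%C).
  { intros j k. apply Uok_scal, Uok_monomial. }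
  rewrite <- (U_ext n _ _ z (fun w => psum_mul a b N w)).
  rewrite (U_CS n (fun j w => CS (fun k => a j * b k * Cpw w (j + k))%C N)).
  - apply CS_ext; intros j _. rewrite (U_CS n (fun k w => a j * b k * Cpw w (j + k))%C) by apply Hok.
    apply CS_ext; intros k _. apply U_scal, Uok_monomial.
  - intros j. apply (Uok_CS n (fun k w => a j * b k * Cpw w (j + k))%C), Hok.
Qed.

Lemma psum_defect_le n a b r z N : (1 <= n)%nat -> 1 <= r -> Cmod z <= r ->
  ex_series (dseq a b r) ->
  Cmod (U n (fun w => psum a N w * psum b N w)%C z - U n (psum a N) z * U n (psum b N) z)
  <= 4 / INR n * Series (dseq a b r).
Proof.
  intros Hn Hr Hz Hex.
  rewrite U_psum_mul, !U_psum, CS_mul, <- CS_minus.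
  set (M := fun p => U n (fun w => Cpw w p) z).
  set (T := fun j k => Cmod (a j) * Cmod (b k) * (INR (j + k) ^ 2 * r ^ (j + k))).
  assert (HT : forall j k, 0 <= T j k).
  { intros j k. apply Rmult_le_pos; apply Rmult_le_pos; try apply Cmod_ge_0.
    - apply pow_le, pos_INR.
    - apply pow_le; lra. }
  assert (H4 : 0 <= 4 / INR n) by (apply Rdiv_le_0_compat; [lra|now apply lt_0_INR]).
  apply Rle_trans with (RS (fun j => RS (fun k => 4 / INR n * T j k) N) N).
  - apply Cmod_CS_le. intros j _. rewrite <- CS_minus. apply Cmod_CS_le. intros k _.
    fold (M (j + k)%nat) (M j) (M k).
    replace (_ - _)%C with (a j * b k * (M (j + k)%nat - M j * M k))%C by ring.
    rewrite !Cmod_mult.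
    replace (4 / INR n * T j k) with
      (Cmod (a j) * Cmod (b k) * (4 / INR n * (INR (j + k) ^ 2 * r ^ (j + k)))) by (unfold T; ring).
    apply Rmult_le_compat_l; [apply Rmult_le_pos; apply Cmod_ge_0|].
    exact (Cmod_monomial_defect n z r Hn Hr Hz j k).
  - rewrite (RS_ext _ (fun j => 4 / INR n * RS (T j) N)) by (intros; apply RS_scal).
    rewrite RS_scal. apply Rmult_le_compat_l; [exact H4|].
    eapply Rle_trans; [apply (RS_square_le T N HT)|].
    eapply Rle_trans; [|apply (RS_le_Series (dseq a b r) (N + N)); [intros; apply dseq_pos; lra|exact Hex]].
    (* On the antidiagonal [j + k = m] the factor [m^2 r^m] is constant and comes out, leaving the
       convolution in [dseq]. *)
    right. apply RS_ext. intros m _. unfold dseq.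
    change (@sum_n R_AbelianGroup ?u m) with (RS u m).
    rewrite Rmult_comm, <- Rmult_assoc, <- RS_scal. apply RS_ext. intros j Hj. unfold T.
    replace (j + (m - j))%nat with m by lia. ring.
Qed.

Theorem theorem5p1 (R0 : R) (f g : C -> C) (a b : nat -> C) (r : R) :
  1 < R0 ->
  (forall z : C, Cmod z < R0 -> is_series (fun k => (a k * Cpw z k)%C) (f z)) ->
  (forall z : C, Cmod z < R0 -> is_series (fun k => (b k * Cpw z k)%C) (g z)) ->
  1 <= r -> r < R0 ->
  ex_series (dseq a b r) /\
  (forall n : nat, (1 <= n)%nat ->
     forall z : C, Cmod z <= r ->
       Cmod (U n (fun w => f w * g w)%C z - U n f z * U n g z)%C
         <= 4 / INR n * Series (dseq a b r)).
Proof.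
  intros _ Hf Hg Hr HrR.
  (* A radius inside the disc of convergence, beyond [r] for the numerical series and beyond 1 for
     uniform convergence on [[0,1]]. *)
  set (rho := (r + R0) / 2).
  assert (Hrho : r < rho < R0) by (unfold rho; lra).
  assert (Hrho1 : 1 < rho < R0) by lra.
  assert (Hrhom : Cmod (RtoC rho) < R0) by (rewrite Cmod_R, Rabs_pos_eq; lra).
  assert (Hex : ex_series (dseq a b r)).
  { exact (ex_series_dseq a b r rho _ _ (conj Hr (proj1 Hrho)) (Hf _ Hrhom) (Hg _ Hrhom)). }
  split; [exact Hex|]. intros n Hn z Hz.
  destruct (psum_unif R0 rho f a Hrho1 Hf) as [A [HA0 HA]].
  destruct (psum_unif R0 rho g b Hrho1 Hg) as [B [HB0 HB]].
  set (q := / rho) in *.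
  assert (Hq : 0 < q < 1).
  { split; [apply Rinv_0_lt_compat; lra|]. rewrite <- Rinv_1. apply Rinv_lt_contravar; lra. }
  assert (Hgeom : forall K, is_lim_seq (fun N => K * q ^ N) 0).
  { intros K. replace (Finite 0) with (Finite (K * 0)) by (f_equal; ring).
    apply is_lim_seq_mult'; [apply is_lim_seq_const|]. apply is_lim_seq_geom.
    rewrite Rabs_pos_eq; lra. }
  assert (Hqn : forall N, 0 <= q ^ N <= 1).
  { intros N. split; [apply pow_le; lra|]. rewrite <- (pow1 N). apply pow_incr; lra. }
  assert (Ht : forall t, 0 <= t <= 1 -> Cmod (RtoC t) <= 1).
  { intros t H. rewrite Cmod_R, Rabs_pos_eq; lra. }
  (* The case [N = 0] of the uniform estimate already bounds the function on the closed unit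
     disc. *)
  assert (Hbound : forall (h : C -> C) c K, 0 <= K ->
     (forall N w, Cmod w <= 1 -> Cmod (psum c N w - h w) <= K * q ^ N) ->
     forall w, Cmod w <= 1 -> Cmod (h w) <= Cmod (c 0%nat) + K).
  { intros h c K HK H w Hw.
    replace (h w) with (c 0%nat + - (psum c 0 w - h w))%C
      by (unfold psum; rewrite CS_O, Cpw_O; ring).
    eapply Rle_trans; [apply Cmod_triangle|]. rewrite Cmod_opp.
    apply Rplus_le_compat_l. specialize (H 0%nat w Hw). simpl in H. lra. }
  set (GA := Cmod (a 0%nat) + A). set (GB := Cmod (b 0%nat) + B).
  assert (Lf : Ctends (fun N => U n (psum a N) z) (U n f z)).
  { apply (U_tends n (psum a) f (fun N => A * q ^ N)); [apply Uok_psum| |apply Hgeom].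
    intros N t H. apply HA. now apply Ht. }
  assert (Lg : Ctends (fun N => U n (psum b N) z) (U n g z)).
  { apply (U_tends n (psum b) g (fun N => B * q ^ N)); [apply Uok_psum| |apply Hgeom].
    intros N t H. apply HB. now apply Ht. }
  assert (Lfg : Ctends (fun N => U n (fun w => psum a N w * psum b N w)%C z)
                       (U n (fun w => f w * g w)%C z)).
  (* The constant comes from [f_N g_N - f g = (f_N - f) g_N + f (g_N - g)], with [|g_N| <= B + GB]
     and [|f| <= GA]. *)
  { apply (U_tends n (fun N w => psum a N w * psum b N w)%C (fun w => f w * g w)%C
      (fun N => (A * (B + GB) + GA * B) * q ^ N)); [intros; apply Uok_psum_mul| |apply Hgeom].
    intros N t H. apply Ht in H. set (w := RtoC t) in *.
    pose proof (Hbound f a A HA0 HA w H) as Bf. pose proof (Hbound g b B HB0 HB w H) as Bg.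
    fold GA in Bf. fold GB in Bg.
    specialize (HA N w H). specialize (HB N w H). specialize (Hqn N).
    replace (_ - _)%C with ((psum a N w - f w) * ((psum b N w - g w) + g w)
      + f w * (psum b N w - g w))%C by ring.
    eapply Rle_trans; [apply Cmod_triangle|]. rewrite !Cmod_mult.
    replace ((A * (B + GB) + GA * B) * q ^ N) with
      (A * q ^ N * (B + GB) + GA * (B * q ^ N)) by ring.
    apply Rplus_le_compat; apply Rmult_le_compat; try apply Cmod_ge_0; try assumption.
    eapply Rle_trans; [apply Cmod_triangle|].
    apply Rplus_le_compat; [|exact Bg]. nra. }
  (* The defects of the partial sums converge to that of [f] and [g], and all obey the same bound,
     which therefore holds up to any [eps]. *)
  pose proof (Ctends_plus _ _ _ _ Lfg (Ctends_opp _ _ (Ctends_mult _ _ _ _ Lf Lg))) as L.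
  apply le_epsilon. intros eps Heps.
  apply is_lim_seq_spec in L. destruct (L (mkposreal eps Heps)) as [N HN].
  specialize (HN N (Nat.le_refl N)). simpl in HN.
  rewrite Rminus_0_r, Rabs_pos_eq in HN by apply Cmod_ge_0.
  pose proof (psum_defect_le n a b r z N Hn Hr Hz Hex) as Hle.
  set (E := (U n (fun w => f w * g w)%C z - U n f z * U n g z)%C) in *.
  set (EN := (U n (fun w => psum a N w * psum b N w)%C z - U n (psum a N) z * U n (psum b N) z)%C) in *.
  change (Cmod (EN - E) < eps) in HN.
  replace E with (EN + - (EN - E))%C by ring.
  eapply Rle_trans; [apply Cmod_triangle|]. rewrite Cmod_opp.
  apply Rplus_le_compat; [exact Hle|lra].
Qed.
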